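(* Let $n>4$ be an even integer and let $P=(A_1,\dots,A_n)$ be a cyclic $n$-gon (distinct vertices on a circle) with vertices ordered anticlockwise. Then \[\sum_{m=1}^{n}(-1)^{m+1}x(m)S(m)=0,\] where \[ x(m)=\begin{cases} x_{12}\,x_{34}^{c}\displaystyle\prod_{\substack{l=m\\ l\text{ even}}}^{n-2}x_{l,l+1}^{\frac{l-2}{2}}\prod_{\substack{l=5\\ l\text{ odd}}}^{m-1}x_{l,l+1}^{\frac{l-3}{2}}, & m \text{ even};\\[2ex] x_{12}^{a}\displaystyle\prod_{\substack{l=m-1\\ l\text{ even}}}^{n-2}x_{l,l+1}^{\frac{l-2}{2}}\prod_{\substack{l=5\\ l\text{ odd}}}^{m}x_{l,l+1}^{\frac{l-3}{2}}, & m\text{ odd},\ n=6;\\[2ex] x_{12}^{a}x_{34}^{b}\,x_{m-2,m-1}^{\frac{m-5}{2}}\,x_{m,m+1}^{\frac{m-3}{2}}\displaystyle\prod_{\substack{l=m-1\\ l\text{ even}}}^{n-2}x_{l,l+1}^{\frac{l-2}{2}}\prod_{\substack{l=5\\ l\text{ odd}}}^{m-4}x_{l,l+1}^{\frac{l-5}{2}}, & m\text{ odd},\ n>6; \end{cases} \] \[ S(m)=\left(\prod_{k=1}^{m-1}\Big(\prod_{\substack{l=k+1\\ l\text{ even}}}^{m-2}S_{k,l,l+1}\prod_{\substack{l=m+1\\ l\text{ odd}}}^{n-1}S_{k,l,l+1}\Big)\right)\left(\prod_{k=m}^{n-3}\prod_{\substack{l=k+2\\ l\text{ odd}}}^{n-1}S_{k+1,l,l+1}\right)\quad\text{for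 } m \text{ even}, \] \[ \begin{aligned} S(m)={}&S_{m-2,m-1,m+1}\left(\prod_{\substack{l=m+2\\ l\text{ odd}}}^{n-1}S_{m-1,l,l+1}S_{m-2,l,l+1}S_{m-3,l,l+1}\right)\left(\prod_{k=m}^{n-3}\prod_{\substack{l=k+2\\ l\text{ odd}}}^{n-1}S_{k+1,l,l+1}\right)\\ &\cdot\prod_{k=1}^{m-4}\left(\big(S_{k,k+1,k+2}S_{k,k+1,m-1}S_{k,k+1,m+1}\big)^{(k\bmod 2)}\prod_{\substack{l=k+2\\ l\text{ even}}}^{m-2}S_{k,l,l+1}\prod_{\substack{l=m+2\\ l\text{ odd}}}^{n-1}S_{k,l,l+1}\right)\quad\text{for } m\text{ odd}, \end{aligned} \] with $a=1$ if $m\in\{1,3\}$ and $a=0$ otherwise; $b=1$ if $m\in\{1,3,5\}$ and $b=0$ otherwise; $c=0$ if $n=6$ and $c=1$ if $n\ge 8$.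
   Context: For points $A_p=(x_p,y_p)$, $x_{pq}:=(x_q-x_p)^2+(y_q-y_p)^2$ is the squared distance between $A_p$ and $A_q$, and $S_{pqr}:=2[(x_q-x_p)(y_r-y_p)-(y_q-y_p)(x_r-x_p)]$ is four times the signed area of triangle $A_pA_qA_r$; these are entries of the polygonal Heronian frieze of $P$. Conventions: if some index is $\le 0$, then $S_{pqr}=1$ and $x_{pq}=1$; $x_{pq}^{e}=1$ whenever the exponent $e<0$; a product $\prod_{l=\alpha}^{\beta}$ with $\alpha>\beta$ (or with no index of the required parity in range) equals $1$; a subscript ''$l$ even/odd'' restricts the product to indices of that parity; $k \bmod 2\in\{0,1\}$. *)

(* Defs.v *)
From HB Require Import structures.
From mathcomp Require Import all_boot all_order all_algebra.
From mathcomp Require Import reals trigo.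
Set Implicit Arguments. Unset Strict Implicit. Unset Printing Implicit Defensive.
Import Order.TTheory GRing.Theory Num.Theory.
Local Open Scope ring_scope.

(* Points of the plane are pairs (x, y); a polygon is a map A : nat -> R * R,
   of which only the values A 1, ..., A n are used (vertex A_p = A p).
   Indices are natural numbers; the only index <= 0 is 0.  Whenever an index
   in the paper could be negative (m-1, m-2, m-3 ...), we use truncated nat
   subtraction, which maps it to 0, where the convention "= 1" applies. *)

Section Frieze.
Variable R : realType.

Definition xd (A : nat -> R * R) (p q : nat) : R :=
  if (p == 0)%N || (q == 0)%N then 1
  else ((A q).1 - (A p).1) ^+ 2 + ((A q).2 - (A p).2) ^+ 2.

(* S_{pqr} : four times the signed area, = 1 if some index is <= 0 *)
Definition Sa (A : nat -> R * R) (p q r : nat) : R :=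
  if [|| p == 0, q == 0 | r == 0]%N then 1
  else 2 * (((A q).1 - (A p).1) * ((A r).2 - (A p).2)
            - ((A q).2 - (A p).2) * ((A r).1 - (A p).1)).

Definition prodEv (a b : nat) (F : nat -> R) : R :=
  \prod_(a <= l < b.+1 | ~~ odd l) F l.
Definition prodOd (a b : nat) (F : nat -> R) : R :=
  \prod_(a <= l < b.+1 | odd l) F l.
Definition prodAll (a b : nat) (F : nat -> R) : R :=
  \prod_(a <= l < b.+1) F l.

(* x(m); exponents are natural numbers: every exponent that is negative in the
   paper (hence the factor is 1 by convention) becomes 0 by truncation, and
   every nonnegative exponent is computed exactly (the halvings are exact). *)
Definition xm (A : nat -> R * R) (n m : nat) : R :=
  let x := xd A in
  let a : nat := if (m == 1)%N || (m == 3)%N then 1%N else 0%N in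
  let b : nat := if [|| m == 1, m == 3 | m == 5]%N then 1%N else 0%N in
  let c : nat := if (n == 6)%N then 0%N else 1%N in
  if ~~ odd m then
    x 1 2 * x 3 4 ^+ c
    * prodEv m (n - 2)%N (fun l => x l l.+1 ^+ (l - 2)%N./2)
    * prodOd 5 (m - 1)%N (fun l => x l l.+1 ^+ (l - 3)%N./2)
  else if (n == 6)%N then
    x 1 2 ^+ a
    * prodEv (m - 1)%N (n - 2)%N (fun l => x l l.+1 ^+ (l - 2)%N./2)
    * prodOd 5 m (fun l => x l l.+1 ^+ (l - 3)%N./2)
  else
    x 1 2 ^+ a * x 3 4 ^+ b
    * x (m - 2)%N (m - 1)%N ^+ (m - 5)%N./2 * x m m.+1 ^+ (m - 3)%N./2
    * prodEv (m - 1)%N (n - 2)%N (fun l => x l l.+1 ^+ (l - 2)%N./2)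
    * prodOd 5 (m - 4)%N (fun l => x l l.+1 ^+ (l - 5)%N./2).

Definition Sm (A : nat -> R * R) (n m : nat) : R :=
  let S := Sa A in
  if ~~ odd m then
    prodAll 1 (m - 1)%N (fun k =>
        prodEv k.+1 (m - 2)%N (fun l => S k l l.+1)
      * prodOd m.+1 (n - 1)%N (fun l => S k l l.+1))
    * prodAll m (n - 3)%N (fun k => prodOd k.+2 (n - 1)%N (fun l => S k.+1 l l.+1))
  else
    S (m - 2)%N (m - 1)%N m.+1
    * prodOd m.+2 (n - 1)%N (fun l =>
        S (m - 1)%N l l.+1 * S (m - 2)%N l l.+1 * S (m - 3)%N l l.+1)
    * prodAll m (n - 3)%N (fun k => prodOd k.+2 (n - 1)%N (fun l => S k.+1 l l.+1))
    * prodAll 1 (m - 4)%N (fun k =>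
        (S k k.+1 k.+2 * S k k.+1 (m - 1)%N * S k k.+1 m.+1) ^+ (k %% 2)%N
      * prodEv k.+2 (m - 2)%N (fun l => S k l l.+1)
      * prodOd m.+2 (n - 1)%N (fun l => S k l l.+1)).

Definition cyclic_anticlockwise (n : nat) (A : nat -> R * R) : Prop :=
  (forall i j, (1 <= i <= n)%N -> (1 <= j <= n)%N -> A i = A j -> i = j) /\
  exists (c : R * R) (r : R) (theta : nat -> R),
    0 < r /\
    (forall i, (1 <= i <= n)%N ->
       A i = (c.1 + r * cos (theta i), c.2 + r * sin (theta i))) /\
    (forall i, (1 <= i < n)%N -> theta i < theta i.+1) /\
    theta n < theta 1%N + 2 * pi.

End Frieze.

(* Main.v *)
(** Write [h i] for half the angle of [A i] and [d p q = 2 r sin (h q - h p)] for the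
    chord, so that [x_{pq} = d p q ^ 2] and, as a triangle of area K and sides a, b, c
    inscribed in a circle of radius r satisfies 4 K = a b c / r, also
    [S_{pqr} = d p q * d q r * d p r / r].  Thus [x(m) S(m)] is a monomial in the chords
    and [1 / r].  Counting exponents, its product with all the chords at the vertex [m] is
    a monomial that does not depend on [m].  The alternating sum is therefore proportional
    to the sum over [m] of the inverses of the products over [j <> m] of
    [sin (h m - h j)].  After a rotation, the substitution t = tan h turns it into
    the sum over [m] of [f (t m) / \prod_(j != m) (t m - t j)] for
    [f = (1 + X^2)^((n - 2) / 2)]; this is the coefficient of [X^(n - 1)] in the Lagrange
    interpolation of [f] at the [n] points [t m], hence [0].  Evenness of [n] is what makes
    [f] a polynomial. *)

Require Import Defs.
From HB Require Import structures.
From mathcomp Require Import all_boot all_order all_algebra.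
From mathcomp Require Import reals trigo.
From mathcomp Require Import zify ring lra.
Import Order.TTheory GRing.Theory Num.Theory.
Local Open Scope ring_scope.

(** * Lagrange interpolation and a sum of inverse products of sines *)

(** [f] and its Lagrange interpolant agree at [size s] distinct points and both have size at most
    [size s], so they are equal. The sum is the coefficient of degree [(size s).-1] of the
    interpolant, a degree that [f] does not reach. *)
Lemma sum_horner_div_prod_eq0 (F : fieldType) (I : eqType) (s : seq I)
    (t : I -> F) (f : {poly F}) :
  uniq s -> {in s &, injective t} -> (size f < size s)%N ->
  \sum_(m <- s) f.[t m] / \prod_(j <- s | j != m) (t m - t j) = 0.
Proof.
move=> s_uniq t_inj szf.
have prod_rem m (G : I -> {poly F}) : m \in s ->
    \prod_(j <- s | j != m) G j = \prod_(j <- rem m s) G j.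
  by move=> ms; rewrite rem_filter // big_filter.
have nz m : m \in s -> \prod_(j <- s | j != m) (t m - t j) != 0.
  move=> ms; rewrite prodf_seq_neq0; apply/allP => j js; apply/implyP => jm.
  by rewrite subr_eq0; apply: contra jm => /eqP /t_inj ->.
pose L m := \prod_(j <- s | j != m) ('X - (t j)%:P).
pose g := \sum_(m <- s) (f.[t m] / \prod_(j <- s | j != m) (t m - t j)) *: L m.
have szL m : m \in s -> size (L m) = size s.
  move=> ms; rewrite /L prod_rem // size_prod_XsubC size_rem //.
  by rewrite prednK //; case: (s) ms.
have fg : f = g.
  apply/eqP; rewrite -subr_eq0; apply/eqP.
  apply: (@roots_geq_poly_eq0 _ _ (map t s)).
  - apply/allP => _ /mapP[m ms ->]; rewrite /root hornerD hornerN /g horner_sum.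
    rewrite (bigD1_seq m) //= [X in _ - (_ + X)]big1_seq => [|j /andP[jm js]].
      rewrite addr0 hornerZ /L horner_prod.
      under [X in _ / _ * X]eq_bigr do rewrite hornerXsubC.
      by rewrite divfK ?nz // subrr.
    rewrite hornerZ /L prod_rem // [X in _ * horner X _](big_rem m) /=.
      by rewrite hornerM hornerXsubC subrr mul0r mulr0.
    by rewrite mem_rem_uniq // inE eq_sym jm.
  - by rewrite map_inj_in_uniq.
  - rewrite size_map (leq_trans (size_polyD _ _)) // geq_max (ltnW szf) size_polyN.
    rewrite (leq_trans (size_sum _ _ _)) //; apply/bigmax_leqP_seq => m ms _.
    by rewrite (leq_trans (size_scale_leq _ _)) // szL.
have /(congr1 (fun p : {poly F} => p`_(size s).-1)) := fg.
have s_gt0 : (0 < size s)%N by case: (size s) szf.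
rewrite nth_default; last by rewrite -ltnS prednK.
move=> g0; rewrite [RHS]g0 /g coef_sum; apply: eq_big_seq => m ms.
rewrite coefZ -[X in _ `_ X](congr1 predn (szL m ms)).
suff /monicP : L m \is monic by rewrite /lead_coef => ->; rewrite mulr1.
by apply: monic_prod => j _; apply: monicXsubC.
Qed.

Lemma sum_inv_prod_sin_eq0 (R : realType) (s : seq nat) (h : nat -> R) :
  uniq s -> (0 < size s)%N -> ~~ odd (size s) ->
  {in s, forall i, cos (h i) != 0} ->
  {in s &, forall i j, i != j -> sin (h i - h j) != 0} ->
  \sum_(m <- s) (\prod_(j <- s | j != m) sin (h m - h j))^-1 = 0.
Proof.
move=> s_uniq s_gt0 s_even cosn0 sinn0.
pose t i := tan (h i); pose k := (size s).-2./2.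
have sk : (k.*2.+2 = size s)%N by rewrite /k; lia.
have sinE i j : i \in s -> j \in s ->
    sin (h i - h j) = cos (h i) * cos (h j) * (t i - t j).
  move=> /cosn0 ci /cosn0 cj; rewrite sinB /t /tan.
  by field; rewrite ci cj.
have t_inj : {in s &, injective t}.
  move=> i j si sj tij; apply/eqP/negP => /negP /(sinn0 i j si sj).
  by rewrite sinE // tij subrr mulr0 eqxx.
pose f : {poly R} := (1 + 'X^2) ^+ k.
have szf : (size f < size s)%N.
  rewrite -sk ltnS (leq_trans (size_poly_exp_leq _ _)) //.
  rewrite [1 + _]addrC size_polyDl ?size_polyXn ?size_poly1 //=.
  by rewrite -muln2 mulnC.
have := sum_horner_div_prod_eq0 _ _ s t f s_uniq t_inj szf.
move=> /(congr1 (fun z => (\prod_(j <- s) cos (h j))^-1 * z)).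
rewrite mulr0 mulr_sumr => E; rewrite -[RHS]E {E}.
apply: eq_big_seq => m ms.
(* Of the [size s - 1] factors [cos (h m)], one completes the product of the cosines over all of
   [s], which leaves the even power [k.*2]. *)
have -> : \prod_(j <- s | j != m) sin (h m - h j)
    = cos (h m) ^+ k.*2 * (\prod_(j <- s) cos (h j)) *
      \prod_(j <- s | j != m) (t m - t j).
  transitivity (\prod_(j <- s | j != m) (cos (h m) * cos (h j) * (t m - t j))).
    by rewrite big_seq_cond [RHS]big_seq_cond; apply: eq_bigr => j /andP[js _]; rewrite sinE.
  rewrite big_split; congr (_ * _).
  rewrite big_split /= [in RHS](bigD1_seq m) //= mulrA -exprSr; congr (_ * _).
  rewrite big_const_seq /= -Monoid.iteropE /= -/(_ ^+ _).
  have := count_predC (pred1 m) s; rewrite count_uniq_mem // ms => cs.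
  by congr (_ ^+ _); rewrite -sk in cs; case: cs.
have cm := cosn0 m ms.
have -> : f.[t m] = (cos (h m) ^+ k.*2)^-1.
  rewrite /f horner_exp hornerD hornerXn hornerC -mul2n exprM -exprVn.
  by congr (_ ^+ _); rewrite /t cos2_tan2.
by rewrite !invfM mulrA [X in X * _]mulrC.
Qed.

Lemma sin_sub_gt0 (R : realType) (n : nat) (h : nat -> R) :
  (forall i, (1 <= i < n)%N -> h i < h i.+1) -> h n < h 1%N + pi ->
  forall p q, (1 <= p)%N -> (p < q)%N -> (q <= n)%N -> 0 < sin (h q - h p).
Proof.
move=> h_incr h_pi.
have h_lt p q : (1 <= p)%N -> (p < q)%N -> (q <= n)%N -> h p < h q.
  move=> p1; elim: q => // q IH; rewrite ltnS leq_eqVlt => /orP[/eqP <-|pq] qn.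
    by apply: h_incr; lia.
  by apply: (lt_trans (IH pq (ltnW qn))); apply: h_incr; lia.
have h_le p q : (1 <= p)%N -> (p <= q)%N -> (q <= n)%N -> h p <= h q.
  by move=> p1; rewrite leq_eqVlt => /orP[/eqP -> //|pq] qn; rewrite ltW // h_lt.
move=> p q p1 pq qn; apply: sin_gt0_pi.
have := h_lt p q p1 pq qn; have := h_le 1%N p isT p1 (ltnW (leq_trans pq qn)).
have := h_le q n (leq_trans p1 (ltnW pq)) qn (leqnn n).
by move=> ? ? ?; apply/andP; split; lra.
Qed.

Lemma sum_inv_prod_sin_lt_eq0 (R : realType) (n : nat) (h : nat -> R) :
  (0 < n)%N -> ~~ odd n ->
  (forall i, (1 <= i < n)%N -> h i < h i.+1) -> h n < h 1%N + pi ->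
  \sum_(1 <= m < n.+1) (\prod_(1 <= j < n.+1 | j != m) sin (h m - h j))^-1 = 0.
Proof.
move=> n0 n_even h_incr h_pi.
have sgt0 := sin_sub_gt0 _ _ _ h_incr h_pi.
(* Centring at the midpoint keeps the differences and puts every angle strictly between [- pi / 2]
   and [pi / 2], where the cosine is positive. *)
pose g i := h i - (h 1%N + h n) / 2.
have sgE i j : sin (h i - h j) = sin (g i - g j) by congr sin; rewrite /g; ring.
under eq_bigr => m _ do under eq_bigr => j _ do rewrite sgE.
apply: sum_inv_prod_sin_eq0; rewrite ?iota_uniq // ?size_iota ?subn1 //.
- have h_le p q : (1 <= p)%N -> (p <= q)%N -> (q <= n)%N -> h p <= h q.
    move=> p1; elim: q => [|q IH]; first by lia.
    rewrite leq_eqVlt => /orP[/eqP <- //|pq] qn.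
    by apply: (le_trans (IH pq (ltnW qn))); apply/ltW/h_incr; lia.
  move=> i; rewrite mem_index_iota => /andP[i1 ilt].
  apply/lt0r_neq0/cos_gt0_pihalf; rewrite /g.
  have := h_le 1%N i isT i1 ilt; have := h_le i n i1 ilt (leqnn n).
  by move=> ? ?; apply/andP; split; lra.
- move=> i j; rewrite !mem_index_iota -sgE => /andP[i1 ilt] /andP[j1 jlt].
  rewrite neq_ltn => /orP[ij|ji]; last by rewrite gt_eqF // sgt0.
  by rewrite -opprB sinN oppr_eq0 gt_eqF // sgt0.
Qed.

(** * Chords and triangles of points on a circle *)

Lemma cosB_sinM (R : realType) (u v : R) :
  cos (2 * v) - cos (2 * u) = 2 * sin (u + v) * sin (u - v).
Proof.
have -> : 2 * v = (u + v) - (u - v) by ring.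
have -> : 2 * u = (u + v) + (u - v) by ring.
by rewrite cosB [cos (_ + (_ - _))]cosD; ring.
Qed.

Lemma sinB_sinM (R : realType) (u v : R) :
  sin (2 * v) - sin (2 * u) = - 2 * cos (u + v) * sin (u - v).
Proof.
have -> : 2 * v = (u + v) - (u - v) by ring.
have -> : 2 * u = (u + v) + (u - v) by ring.
by rewrite sinB [sin (_ + (_ - _))]sinD; ring.
Qed.

Section CirclePoints.
Variables (R : realType) (A : nat -> R * R) (c : R * R) (r : R) (h : nat -> R).

Let d p q := 2 * r * sin (h q - h p).

Let on_circle i := A i = (c.1 + r * cos (2 * h i), c.2 + r * sin (2 * h i)).

Let subDr (a x y : R) : (a + r * x) - (a + r * y) = r * (x - y).
Proof. by ring. Qed.

Lemma xd_circle p q : (0 < p)%N -> (0 < q)%N -> on_circle p -> on_circle q ->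
  xd A p q = d p q ^+ 2.
Proof.
move=> p0 q0 Ap Aq; rewrite /xd !gtn_eqF //= Ap Aq /= !subDr.
rewrite cosB_sinM sinB_sinM.
have -> : sin (h p - h q) = - sin (h q - h p) by rewrite -sinN opprB.
have cs : cos (h p + h q) ^+ 2 = 1 - sin (h p + h q) ^+ 2.
  by rewrite -(cos2Dsin2 (h p + h q)); ring.
transitivity (4 * r ^+ 2 * sin (h q - h p) ^+ 2 *
  (sin (h p + h q) ^+ 2 + cos (h p + h q) ^+ 2)); first by ring.
by rewrite cs /d; ring.
Qed.

(** The vectors from [A p] to [A q] and [A s] are [d p q] and [d p s] times unit vectors whose
    directions differ by the inscribed angle [h s - h q], so their determinant contributes the sine
    of that angle, which is [d q s] up to [2 r]. *)
Lemma Sa_circle p q s : r != 0 -> (0 < p)%N -> (0 < q)%N -> (0 < s)%N ->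
  on_circle p -> on_circle q -> on_circle s ->
  Sa A p q s = r^-1 * d p q * d q s * d p s.
Proof.
move=> r0 p0 q0 s0 Ap Aq As; rewrite /Sa !gtn_eqF //= Ap Aq As /= !subDr.
rewrite !cosB_sinM !sinB_sinM.
have -> : sin (h p - h q) = - sin (h q - h p) by rewrite -sinN opprB.
have -> : sin (h p - h s) = - sin (h s - h p) by rewrite -sinN opprB.
have E : sin (h s - h q) =
    sin (h p + h s) * cos (h p + h q) - cos (h p + h s) * sin (h p + h q).
  by rewrite -sinB; congr sin; ring.
by rewrite /d E; field.
Qed.

End CirclePoints.

(** * Monomials in the chords *)

Section Monomials.
Variables (R : comPzRingType) (n : nat) (d : nat -> nat -> R).

(** Equality of monomials becomes equality of natural exponents, with no division. Row [p = 0]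
    belongs to no vertex and is kept for the factors [1 / r]. *)
Definition has_exponent (x : R) (e : nat -> nat -> nat) : Prop :=
  x = \prod_(0 <= p < n.+1) \prod_(p.+1 <= q < n.+1) d p q ^+ e p q.

Lemma has_exponent_eq x y e f : has_exponent x e -> has_exponent y f ->
  (forall p q, (p < q)%N -> (q <= n)%N -> e p q = f p q) -> x = y.
Proof.
move=> -> -> ef; apply: eq_big_nat => p _; apply: eq_big_nat => q /andP[pq qn].
by rewrite ef.
Qed.

Lemma has_exponent1 : has_exponent 1 (fun _ _ => 0%N).
Proof. by rewrite /has_exponent big1 // => p _; rewrite big1. Qed.

Lemma has_exponentM x y e f : has_exponent x e -> has_exponent y f ->
  has_exponent (x * y) (fun p q => e p q + f p q)%N.
Proof.
move=> -> ->; rewrite /has_exponent -big_split; apply: eq_bigr => p _ /=.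
by rewrite -big_split; apply: eq_bigr => q _ /=; rewrite exprD.
Qed.

Lemma has_exponentX x e k : has_exponent x e ->
  has_exponent (x ^+ k) (fun p q => k * e p q)%N.
Proof.
move=> ->; rewrite /has_exponent -prodrXl; apply: eq_bigr => p _ /=.
by rewrite -prodrXl; apply: eq_bigr => q _ /=; rewrite mulnC exprM.
Qed.

Lemma has_exponent_prod a b (P : pred nat) F e :
  (forall l, (a <= l < b)%N -> P l -> has_exponent (F l) (e l)) ->
  has_exponent (\prod_(a <= l < b | P l) F l)
               (fun p q => \sum_(a <= l < b | P l) e l p q)%N.
Proof.
move=> Fe; rewrite /has_exponent.
transitivity (\prod_(a <= l < b | P l) \prod_(0 <= p < n.+1)
   \prod_(p.+1 <= q < n.+1) d p q ^+ e l p q).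
  rewrite big_seq_cond [RHS]big_seq_cond; apply: eq_bigr => l.
  by rewrite mem_index_iota => /andP[]; exact: Fe.
rewrite exchange_big; apply: eq_bigr => p _ /=.
rewrite exchange_big; apply: eq_bigr => q _ /=.
by rewrite expr_sum.
Qed.

Lemma has_exponent_var p q : (p < q)%N -> (q <= n)%N ->
  has_exponent (d p q) (fun i j => ((i == p) && (j == q) : nat)).
Proof.
move=> pq qn; rewrite /has_exponent (bigD1_seq p) ?iota_uniq ?mem_index_iota //=;
  last by rewrite (leq_trans pq) // ltnW.
rewrite (bigD1_seq q) ?iota_uniq ?mem_index_iota ?pq //= !eqxx.
rewrite !big1 ?mulr1 // => [i /negbTE ip|j /negbTE jq]; last by rewrite jq.
by rewrite big1 // => j _; rewrite ip.
Qed.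

End Monomials.

(** * Exponents of the factors of x(m) and S(m) *)

Definition x_exponent (p q i j : nat) : nat :=
  if (p == 0)%N || (q == 0)%N then 0%N else (2 * ((i == p) && (j == q)))%N.

(* Each [d 0 s] stands for [1 / r].  Spreading these factors over several slots [s], one
   for each pair [l, l + 1] of neighbours in the products, makes the exponent of every
   single slot independent of [m], so that the total need not be computed. *)
Definition S_slot (m r : nat) : nat := if (r < m)%N then r./2 else r.-1./2.

Definition S_exponent (m p q r i j : nat) : nat :=
  if [|| p == 0, q == 0 | r == 0]%N then 0%N
  else ((i == 0) && (j == S_slot m r) + ((i == p) && (j == q))
        + ((i == q) && (j == r)) + ((i == p) && (j == r)))%N.

(** This and [Sm_exponent] keep the shape of [xm] and [Sm] factor by factor, so that the closure
    rules of [has_exponent] apply syntactically. *)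
Definition xm_exponent (n m i j : nat) : nat :=
  let x p q := x_exponent p q i j in
  let a : nat := if (m == 1)%N || (m == 3)%N then 1%N else 0%N in
  let b : nat := if [|| m == 1, m == 3 | m == 5]%N then 1%N else 0%N in
  let c : nat := if (n == 6)%N then 0%N else 1%N in
  (if ~~ odd m then
    x 1 2 + c * x 3 4
    + \sum_(m <= l < (n - 2).+1 | ~~ odd l) (l - 2)./2 * x l l.+1
    + \sum_(5 <= l < (m - 1).+1 | odd l) (l - 3)./2 * x l l.+1
  else if n == 6 then
    a * x 1 2
    + \sum_(m - 1 <= l < (n - 2).+1 | ~~ odd l) (l - 2)./2 * x l l.+1
    + \sum_(5 <= l < m.+1 | odd l) (l - 3)./2 * x l l.+1
  else
    a * x 1 2 + b * x 3 4
    + (m - 5)./2 * x (m - 2) (m - 1) + (m - 3)./2 * x m m.+1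
    + \sum_(m - 1 <= l < (n - 2).+1 | ~~ odd l) (l - 2)./2 * x l l.+1
    + \sum_(5 <= l < (m - 4).+1 | odd l) (l - 5)./2 * x l l.+1)%N.

Definition Sm_exponent (n m i j : nat) : nat :=
  let S p q r := S_exponent m p q r i j in
  (if ~~ odd m then
    \sum_(1 <= k < (m - 1).+1)
        (\sum_(k.+1 <= l < (m - 2).+1 | ~~ odd l) S k l l.+1
         + \sum_(m.+1 <= l < (n - 1).+1 | odd l) S k l l.+1)
    + \sum_(m <= k < (n - 3).+1) \sum_(k.+2 <= l < (n - 1).+1 | odd l) S k.+1 l l.+1
  else
    S (m - 2) (m - 1) m.+1
    + \sum_(m.+2 <= l < (n - 1).+1 | odd l)
        (S (m - 1) l l.+1 + S (m - 2) l l.+1 + S (m - 3) l l.+1)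
    + \sum_(m <= k < (n - 3).+1) \sum_(k.+2 <= l < (n - 1).+1 | odd l) S k.+1 l l.+1
    + \sum_(1 <= k < (m - 4).+1)
        (k %% 2 * (S k k.+1 k.+2 + S k k.+1 (m - 1) + S k k.+1 m.+1)
         + \sum_(k.+2 <= l < (m - 2).+1 | ~~ odd l) S k l l.+1
         + \sum_(m.+2 <= l < (n - 1).+1 | odd l) S k l l.+1))%N.

Section Exponents.
Variables (R : realType) (n : nat) (A : nat -> R * R) (d : nat -> nat -> R).

Hypothesis xdE : forall p q, (0 < p)%N -> (p < q)%N -> (q <= n)%N ->
  xd A p q = d p q ^+ 2.
(** The index [i] is arbitrary because every [d 0 i] will be the same number [1 / r]: each triangle
    may choose its slot. *)
Hypothesis SaE : forall p q s i, (0 < p)%N -> (p < q)%N -> (q < s)%N -> (s <= n)%N ->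
  Sa A p q s = d 0 i * d p q * d q s * d p s.

(** The case [p = 0] covers indices truncated to [0], where the factor is [1]. *)
Lemma xd_exponent p q : (p == 0)%N || (p < q <= n)%N ->
  has_exponent R n d (xd A p q) (x_exponent p q).
Proof.
case: posnP => [-> _|p0 /= /andP[pq qn]].
  by rewrite /xd; apply: has_exponent1.
have q0 := ltn_trans p0 pq; rewrite xdE // /x_exponent !gtn_eqF //=.
by apply: has_exponentX; apply: has_exponent_var.
Qed.

Lemma Sa_exponent m p q s : (p == 0)%N || [&& p < q, q < s & s <= n]%N ->
  has_exponent R n d (Sa A p q s) (S_exponent m p q s).
Proof.
case: posnP => [-> _|p0 /= /and3P[pq qs sn]].
  by rewrite /Sa; apply: has_exponent1.
have q0 := ltn_trans p0 pq; have s0 := ltn_trans q0 qs.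
rewrite (SaE _ _ _ (S_slot m s)) // /S_exponent !gtn_eqF //=.
by repeat apply: has_exponentM; apply: has_exponent_var; rewrite ?/S_slot; try case: ifP; lia.
Qed.

Lemma xm_has_exponent m : (4 < n)%N -> ~~ odd n -> (1 <= m <= n)%N ->
  has_exponent R n d (xm A n m) (xm_exponent n m).
Proof.
move=> n4 n_even m_n; rewrite /xm /xm_exponent /prodEv /prodOd.
case: ifPn => m_odd; last case: ifPn => n6.
- repeat apply: has_exponentM; try (apply: has_exponent_prod => l ? ?);
    try apply: has_exponentX; apply: xd_exponent; lia.
- repeat apply: has_exponentM; try (apply: has_exponent_prod => l ? ?);
    try apply: has_exponentX; apply: xd_exponent; lia.
- repeat apply: has_exponentM; try (apply: has_exponent_prod => l ? ?);
    try apply: has_exponentX; apply: xd_exponent; lia.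
Qed.

Lemma Sm_has_exponent m : (4 < n)%N -> ~~ odd n -> (1 <= m <= n)%N ->
  has_exponent R n d (Sm A n m) (Sm_exponent n m).
Proof.
move=> n4 n_even m_n; rewrite /Sm /Sm_exponent /prodEv /prodOd /prodAll.
case: ifPn => m_odd.
- repeat apply: has_exponentM; apply: has_exponent_prod => k ? ?;
    repeat apply: has_exponentM; apply: has_exponent_prod => l ? ?;
    apply: Sa_exponent; lia.
- repeat apply: has_exponentM; try (apply: has_exponent_prod => k ? ?);
    repeat apply: has_exponentM; try apply: has_exponentX;
    try (apply: has_exponent_prod => l ? ?);
    repeat apply: has_exponentM; apply: Sa_exponent; lia.
Qed.

End Exponents.

(** * Counting exponents *)

Lemma sum_eq_pt a b (P : pred nat) (G : nat -> nat) u :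
  (\sum_(a <= l < b | P l) (if l == u then G l else 0)
    = if [&& a <= u, u < b & P u] then G u else 0)%N.
Proof.
case: ifPn => [/and3P[au ub Pu]|Nu].
  rewrite big_mkcond (bigD1_seq u) ?mem_index_iota ?iota_uniq ?au //= Pu eqxx.
  by rewrite big1 ?addn0 // => l /negbTE ->; case: ifP.
rewrite big_nat_cond big1 // => l /andP[/andP[al lb] Pl].
by case: eqP => // lu; move: Nu; rewrite -lu al lb Pl.
Qed.

Lemma sum_ltn a b v : (\sum_(a <= k < b) (k < v : nat) = minn b v - a)%N.
Proof.
elim: b => [|b IH]; first by rewrite big_geq // min0n.
by case: (leqP a b) => ab; [rewrite big_nat_recr //= IH|rewrite big_geq //]; lia.
Qed.

(** * Exponents in a double product of triangles on pairs of neighbours *)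

Section Block.
Variables (m a b hi : nat) (f : nat -> nat) (P : pred nat) (par : bool).
Hypothesis a_gt0 : (0 < a)%N.
Hypothesis f_gt : forall k, (a <= k < b)%N -> (k < f k)%N.
Hypothesis P_par : forall l, P l = (odd l == par).
(** For even [l] the pair [l, l + 1] lies before [m], for odd [l] it lies from [m] on; either branch
    of [S_slot] then gives the slot [l./2]. *)
Hypothesis P_slot : forall k l, (a <= k < b)%N -> (f k <= l <= hi)%N -> P l ->
  if par then (m <= l)%N else (l.+1 < m)%N.

Let block i j :=
  (\sum_(a <= k < b) \sum_(f k <= l < hi.+1 | P l) S_exponent m k l l.+1 i j)%N.

Let blockE (G : nat -> nat -> nat) i j :
  (forall k l, (a <= k < b)%N -> (f k <= l <= hi)%N -> odd l == par ->
    (k < l)%N -> (0 < k)%N ->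
    ((i == 0) && (j == l./2) + ((i == k) && (j == l))
      + ((i == l) && (j == l.+1)) + ((i == k) && (j == l.+1)) = G k l)%N) ->
  block i j = (\sum_(a <= k < b) \sum_(f k <= l < hi.+1 | P l) G k l)%N.
Proof.
move=> SG; apply: eq_big_nat => k kab; rewrite big_nat_cond [RHS]big_nat_cond.
apply: eq_bigr => l /andP[lhi Pl]; have fk := f_gt k kab.
have sl := P_slot k l kab lhi Pl; move: (Pl); rewrite P_par => pl.
have k0 : (0 < k)%N by lia.
have kl : (k < l)%N by lia.
have slot_l : S_slot m l.+1 = l./2.
  by move: sl pl; rewrite /S_slot; case: par => /=; case: ifP; lia.
have l0 := ltn_trans k0 kl.
by rewrite /S_exponent (gtn_eqF k0) (gtn_eqF l0) /= slot_l SG.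
Qed.

(** Only [l = 2 j + par] has the right parity and the slot [j], so one triangle is counted for each
    admissible [k]. *)
Lemma block_slot j : block 0 j =
  (if j.*2 + par <= hi then \sum_(a <= k < b) (f k <= j.*2 + par : nat) else 0)%N.
Proof.
rewrite (blockE (fun _ l => if l == (j.*2 + par)%N then 1 else 0)%N); last first.
  move=> k l ? ? pl kl k0.
  by move: pl; case: par => /= pl; case: ifP; lia.
under eq_bigr do rewrite sum_eq_pt.
have Pj : P (j.*2 + par) by rewrite P_par; case: par; lia.
rewrite Pj; case: (leqP (j.*2 + par) hi) => jhi.
  by apply: eq_bigr => k _; rewrite ltnS jhi andbT; case: leqP.
by rewrite big1 // => k _; case: ifP => //; lia.
Qed.

(** A side [i, i + 1] is either the pair itself, [l = i] with any [k], or joins the apex [k = i] to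
    [l = i + 1]. *)
Lemma block_edge i : (0 < i)%N -> block i i.+1 =
  ((if (odd i == par) && (i <= hi) then \sum_(a <= k < b) (f k <= i : nat) else 0)
   + if [&& a <= i, i < b, f i <= i.+1, i.+1 <= hi & odd i != par] then 1 else 0)%N.
Proof.
move=> i0.
rewrite (blockE (fun k l => (if l == i then 1 else 0) +
   (if l == i.+1 then (k == i : nat) else 0))%N); last first.
  move=> k l ? ? pl kl k0.
  by do !case: ifP; lia.
under eq_bigr do rewrite big_split /= !sum_eq_pt.
rewrite big_split /=; congr (_ + _)%N.
  rewrite P_par; case: ifP => [/andP[pi ihi]|Ni].
    by apply: eq_bigr => k _; rewrite ltnS pi ihi andbT; case: leqP.
  by rewrite big1 // => k _; case: ifP => //; lia.
rewrite P_par (eq_bigr (fun k => if k == i then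
  if [&& f i <= i.+1, i.+1 <= hi & odd i != par] then 1 else 0 else 0))%N; last first.
  move=> k _; case: (eqVneq k i) => [->|]; last by case: ifP.
  by rewrite ltnS /=; congr (if [&& _, _ & _] then _ else _); case: (odd i); case: par.
by rewrite sum_eq_pt; do !case: ifP; lia.
Qed.

(** A diagonal forces [k = i], and [j] is [l] or [l + 1]; parity decides which, so [v] is the only
    possible [l]. *)
Lemma block_far i j : (0 < i)%N -> (i.+1 < j)%N -> block i j =
  (let v := if odd j == par then j else j.-1 in
   if [&& a <= i, i < b, f i <= v & v <= hi] then 1 else 0)%N.
Proof.
move=> i0 ij; cbv zeta; set v := if odd j == par then j else j.-1.
have Pv : P v.
  have oj : odd j.-1 = ~~ odd j by rewrite -{2}(ltn_predK ij) /= negbK.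
  by rewrite P_par /v; case: ifP => //; rewrite oj; case: (odd j); case: par.
rewrite (blockE (fun k l => if l == v then (k == i : nat) else 0)%N); last first.
  move=> k l _ _ /eqP pl _ _; rewrite (gtn_eqF i0) /=.
  have -> : (i == l) && (j == l.+1) = false.
    by apply/negbTE/negP => /andP[/eqP il /eqP jl]; move: ij; rewrite jl il ltnn.
  rewrite addn0 add0n /v -pl; case: (eqVneq i k) => _ /=; last by case: ifP.
  case: (eqVneq j l) => [->|jl]; first by rewrite !eqxx (ltn_eqF (ltnSn l)).
  case: (eqVneq j l.+1) => [->|lj] /=.
    by case: (odd l); rewrite /= eqxx.
  case: (odd j == odd l); first by rewrite eq_sym (negbTE jl).
  by rewrite -eqSS prednK 1?eq_sym ?(negbTE lj) // (leq_trans _ ij).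
under eq_bigr do rewrite sum_eq_pt Pv.
rewrite (eq_bigr (fun k => if k == i then
  if (f i <= v) && (v <= hi) then 1 else 0 else 0))%N; last first.
  by move=> k _; case: (eqVneq k i) => [->|]; [rewrite ltnS andbT; case: ifP|case: ifP].
rewrite sum_eq_pt andbT [in RHS]andbA; case: ((a <= i) && (i < b))%N => //.
Qed.

End Block.

(* Only conditions that [lia] cannot decide are split on: splitting on all of them would be
   exponential in their number. *)
Ltac decide_with_lia c :=
  lazymatch c with
  | context [if ?a then _ else _] => decide_with_lia a
  | ?a && _ => decide_with_lia a
  | ?a || _ => decide_with_lia a
  | ~~ ?a => decide_with_lia a
  | _ => first [ rewrite (_ : c = true) /=; last by lia
               | rewrite (_ : c = false) /=; last by lia
               | case: (boolP c) => /= ? ]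
  end.

Ltac lia_ifs :=
  repeat match goal with
  | |- context [if ?c then _ else _] => decide_with_lia c
  | |- context [nat_of_bool ?c] => decide_with_lia c
  end;
  lia.

Lemma S_exponent_slot m p q r j : (0 < p)%N -> (0 < q)%N -> (0 < r)%N ->
  S_exponent m p q r 0 j = (j == S_slot m r).
Proof. by case: p q r => [|p] [|q] [|r] //; rewrite /S_exponent /= !addn0. Qed.

Lemma S_exponent_pair m p q r i j : (0 < p)%N -> (0 < q)%N -> (0 < r)%N -> (0 < i)%N ->
  S_exponent m p q r i j
  = ((i == p) && (j == q) + ((i == q) && (j == r)) + ((i == p) && (j == r)))%N.
Proof. by case: p q r i => [|p] [|q] [|r] [|i]. Qed.

(** The exponents, free of [m], of the product of x(m) S(m) with all chords at [m]. Each diagonal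
    occurs once. Among the sides only [3, 4] depends on [n]: its cube enters S(m) only for odd
    [m >= 7], hence never when [n = 6]. *)
Definition common_exponent (n i j : nat) : nat :=
  (if i == 0 then if j.*2 < n then j.*2.-1 else 0
   else if j == i.+1 then
     if i == 1 then 3 else if i == 3 then (if n == 6 then 1 else 3)
     else if odd i then i - 2 else i.-1
   else 1)%N.

(** * Exponents of S(m) and of the whole product *)

Section Counting.
Variables (n m : nat).
Hypotheses (n_gt4 : (4 < n)%N) (n_even : ~~ odd n) (m_bounds : (1 <= m <= n)%N).

Let block a b hi (f : nat -> nat) (P : pred nat) i j :=
  (\sum_(a <= k < b) \sum_(f k <= l < hi.+1 | P l) S_exponent m k l l.+1 i j)%N.

Let above i j :
  (\sum_(m <= k < (n - 3).+1) \sum_(k.+2 <= l < (n - 1).+1 | odd l)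
     S_exponent m k.+1 l l.+1 i j
   = block m.+1 (n - 1) (n - 1) S odd i j)%N.
Proof. by rewrite /block big_add1 (_ : (n - 1).-1 = (n - 3).+1)%N //; lia. Qed.

(** For even [m] the vertices other than [1] and [m] form the pairs [2, 3] to [m - 2, m - 1] and
    [m + 1, m + 2] to [n - 1, n]. Every vertex [k] other than [m] spans a triangle with each later
    pair; the blocks sort these by the sides of [m] on which [k] and the pair lie. *)
Lemma Sm_exponent_even i j : ~~ odd m -> Sm_exponent n m i j =
  (block 1 m (m - 2) S (fun l => ~~ odd l) i j + block 1 m (n - 1) (fun=> m.+1) odd i j
   + block m.+1 (n - 1) (n - 1) S odd i j)%N.
Proof.
move=> m_even; rewrite /Sm_exponent m_even above big_split /= /block.
by rewrite (_ : (m - 1).+1 = m) //; lia.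
Qed.

(** For odd [m] the vertices [m - 1] and [m + 1] belong to no pair. These triangles, for odd [k],
    join them to the earlier vertices two at a time, and supply the chord [k, k + 2] that the
    products over [l >= k + 2] omit. *)
Let extra i j := (\sum_(1 <= k < (m - 4).+1) k %% 2 *
  (S_exponent m k k.+1 k.+2 i j + S_exponent m k k.+1 (m - 1) i j
   + S_exponent m k k.+1 m.+1 i j))%N.

(** The factors singled out for [k = m - 3], [m - 2] and [m - 1] extend the product over [k] up to
    [m - 4] to a block over all [k < m]. *)
Lemma Sm_exponent_odd i j : odd m -> Sm_exponent n m i j =
  (S_exponent m (m - 2) (m - 1) m.+1 i j + extra i j
   + block 1 (m - 4).+1 (m - 2) (fun k => k.+2) (fun l => ~~ odd l) i j
   + block 1 m (n - 1) (fun=> m.+2) odd i j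
   + block m.+1 (n - 1) (n - 1) S odd i j)%N.
Proof.
move=> m_odd; rewrite /Sm_exponent m_odd /= above !big_split /=.
rewrite -/(extra i j).
pose g k := (\sum_(m.+2 <= l < (n - 1).+1 | odd l) S_exponent m k l l.+1 i j)%N.
have -> : block 1 m (n - 1) (fun=> m.+2) odd i j =
    (\sum_(1 <= k < (m - 4).+1) g k + g (m - 3) + g (m - 2) + g (m - 1))%N.
  rewrite /block -/(g _); case: (ltnP 3 m) => m3.
    have -> : (m - 1 = (m - 4).+3)%N by lia.
    have -> : (m - 2 = (m - 4).+2)%N by lia.
    have -> : (m - 3 = (m - 4).+1)%N by lia.
    have -> : index_iota 1 m = index_iota 1 (m - 4).+4 by congr index_iota; lia.
    by rewrite !(big_nat_recr _.+1 1).
  (* For [m = 1] and [m = 3] truncated subtraction produces the index [0], which contributes no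
     exponent. *)
  have g0 : g 0 = 0%N by rewrite /g big1 // => l _; rewrite /S_exponent.
  have -> : (m - 3 = 0)%N by lia.
  have -> : (m - 4 = 0)%N by lia.
  have [m1|m3'] : m = 1%N \/ m = 3%N by lia.
    have [-> ->] : (m - 2 = 0)%N /\ (m - 1 = 0)%N by lia.
    by rewrite g0 !big_geq ?m1.
  have -> : (m - 2 = 1)%N by lia.
  have -> : (m - 1 = 2)%N by lia.
  have -> : index_iota 1 m = [:: 1; 2]%N by rewrite m3'.
  have -> : index_iota 1 1 = [::] by [].
  by rewrite g0 !big_cons !big_nil !addn0 !add0n.
by rewrite /g /block /=; ring.
Qed.

Lemma sum_odd_const b c : (\sum_(1 <= k < b.+1 | odd k) c = b.+1./2 * c)%N.
Proof.
elim: b => [|b IH]; first by rewrite big_geq.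
have bE : (b.+2./2 = b.+1./2 + odd b.+1)%N by lia.
rewrite big_mkcond big_nat_recr // -big_mkcond IH bE mulnDl.
by case: (odd b.+1); rewrite ?mul1n.
Qed.

Let extraE G i j : odd m ->
  (forall k, (0 < k)%N -> (k + 4 <= m)%N -> odd k ->
   (S_exponent m k k.+1 k.+2 i j + S_exponent m k k.+1 (m - 1) i j
    + S_exponent m k k.+1 m.+1 i j = G k)%N) ->
  extra i j = (\sum_(1 <= k < (m - 4).+1 | odd k) G k)%N.
Proof.
move=> m_odd SG; rewrite /extra big_nat_cond [RHS]big_mkcond [RHS]big_nat_cond.
apply: eq_bigr => k /andP[/andP[k0 km] _]; rewrite modn2.
by case: ifP => ko; rewrite ?mul0n // mul1n SG //; lia.
Qed.

(** The triangle [k, k + 1, k + 2] has slot [j] for [k = 2 j - 1]. The other two both have slot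
    [(m - 1) / 2], and there are [(m - 3) / 2] odd [k]. *)
Lemma extra_slot j : odd m -> (0 < j)%N -> extra 0 j =
  ((if j.*2 + 3 <= m then 1 else 0) + (if j.*2.+1 == m then m - 3 else 0))%N.
Proof.
move=> m_odd j0.
rewrite (extraE (fun k => (if k == j.*2.-1 then 1 else 0) +
   (if j.*2.+1 == m then 2 else 0))%N) //.
  rewrite big_split /= sum_eq_pt sum_odd_const.
  by congr (_ + _)%N; do !case: ifP; lia.
move=> k k0 km ko; have m1 : (0 < m - 1)%N by lia.
rewrite !S_exponent_slot // /S_slot.
have -> : (k.+2 < m)%N by lia.
have -> : (m - 1 < m)%N by lia.
have -> : (m.+1 < m)%N = false by lia.
have -> : (j == k.+2./2) = (k == j.*2.-1) by lia.
have -> : (j == (m - 1)./2) = (j.*2.+1 == m) by lia.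
have -> : (j == m.+1.-1./2) = (j.*2.+1 == m) by lia.
by do 2!case: (_ == _).
Qed.

(** For odd [i] all three triangles with [k = i] contain the side. For even [i] only the first one
    with [k = i - 1] does, which explains the bound shifted by [~~ odd i]. *)
Lemma extra_edge i : odd m -> (0 < i)%N -> extra i i.+1 =
  (if i + 4 <= m + ~~ odd i then (if odd i then 3 else 1) else 0)%N.
Proof.
move=> m_odd i0.
rewrite (extraE (fun k => (if k == i then 3 else 0) + (if k == i.-1 then 1 else 0))%N) //.
  by rewrite big_split /= !sum_eq_pt; do !case: ifP; lia.
move=> k k0 km ko; have m1 : (0 < m - 1)%N by lia.
rewrite !S_exponent_pair //=.
have [->|ik] := eqVneq i k.
  by rewrite !eqxx (_ : (k == k.-1) = false) /=; lia.
have [->|ik1] := eqVneq i k.+1; first by rewrite /= !eqxx /=; lia.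
by rewrite (_ : (k == i.-1) = false) //; lia.
Qed.

Lemma extra_far i j : odd m -> (0 < i)%N -> (i.+1 < j)%N -> extra i j =
  (if i + 4 <= m + ~~ odd i then
     (odd i && (j == i.+2)) + (j == m - 1) + (j == m.+1) else 0)%N.
Proof.
move=> m_odd i0 ij.
rewrite (extraE (fun k =>
    (if k == i then (j == i.+2) + (j == m - 1) + (j == m.+1) else 0) +
    (if k == i.-1 then (j == m - 1) + (j == m.+1) else 0))%N) //.
  by rewrite big_split /= !sum_eq_pt; lia_ifs.
move=> k k0 km ko; have m1 : (0 < m - 1)%N by lia.
rewrite !S_exponent_pair //=.
have [ik|ik] := eqVneq i k.
  rewrite -ik ?eqxx (gtn_eqF ij) (ltn_eqF (ltnSn i)) (_ : (i == i.-1) = false) /=; lia.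
have [ik1|ik1] := eqVneq i k.+1.
  by rewrite ik1 /= ?eqxx (_ : (j == k.+2) = false) //=; lia.
by rewrite (_ : (k == i.-1) = false) //; lia.
Qed.

(** Slot [j] collects the triangles on one pair: [2 j, 2 j + 1] before [m], with [2 j - 1] earlier
    vertices, or [2 j + 1, 2 j + 2] after [m], with [2 j] earlier vertices, one of them the excluded
    [m]. *)
Let Sm_slot_even j : ~~ odd m -> (0 < j)%N -> (j <= n)%N -> Sm_exponent n m 0 j =
  (if j.*2 < n then j.*2.-1 else 0)%N.
Proof.
move=> m_even j0 jn; rewrite Sm_exponent_even //.
rewrite (_ : block 1 m (m - 2) S _ 0 j = (if j.*2 + false <= m - 2 then
  \sum_(1 <= k < m) (k < j.*2 + false : nat) else 0)%N); last first.
  by apply: block_slot => // *; lia.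
rewrite (_ : block 1 m (n - 1) _ _ 0 j = (if j.*2 + true <= n - 1 then
  \sum_(1 <= k < m) (m.+1 <= j.*2 + true : nat) else 0)%N); last first.
  by apply: block_slot => // *; lia.
rewrite (_ : block m.+1 (n - 1) (n - 1) _ _ 0 j = (if j.*2 + true <= n - 1 then
  \sum_(m.+1 <= k < n - 1) (k < j.*2 + true : nat) else 0)%N); last first.
  by apply: block_slot => // *; lia.
rewrite !sum_ltn sum_nat_const_nat.
case: (ltnP m j.*2) => mj.
  rewrite (_ : (j.*2 + false <= m - 2) = false)%N; last by lia.
  by rewrite (_ : (m < j.*2 + true) = true)%N; [case: ifP; case: ifP|]; lia.
rewrite (_ : (m < j.*2 + true) = (m == j.*2))%N; last by lia.
by case: eqP; case: ifP; case: ifP; case: ifP; lia.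
Qed.

(** After [m] the count is as for even [m]. At [2 j + 1 = m] the slot holds [m - 3] triangles of
    [extra] and the leading one; below, one triangle of [extra] completes the [2 j - 2] of the
    block. *)
Let Sm_slot_odd j : odd m -> (0 < j)%N -> (j <= n)%N -> Sm_exponent n m 0 j =
  (if j.*2 < n then j.*2.-1 else 0)%N.
Proof.
move=> m_odd j0 jn; rewrite Sm_exponent_odd // -/(extra 0 j) extra_slot //.
rewrite (_ : block 1 (m - 4).+1 (m - 2) _ _ 0 j = (if j.*2 + false <= m - 2 then
  \sum_(1 <= k < (m - 4).+1) (k.+2 <= j.*2 + false : nat) else 0)%N); last first.
  by apply: block_slot => // *; lia.
rewrite (_ : block 1 m (n - 1) _ _ 0 j = (if j.*2 + true <= n - 1 then
  \sum_(1 <= k < m) (m.+2 <= j.*2 + true : nat) else 0)%N); last first.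
  by apply: block_slot => // *; lia.
rewrite (_ : block m.+1 (n - 1) (n - 1) _ _ 0 j = (if j.*2 + true <= n - 1 then
  \sum_(m.+1 <= k < n - 1) (k < j.*2 + true : nat) else 0)%N); last first.
  by apply: block_slot => // *; lia.
rewrite (eq_bigr (fun k => (k < j.*2.-1 : nat))%N); last by move=> k _; congr nat_of_bool; lia.
rewrite !sum_ltn sum_nat_const_nat.
have -> : S_exponent m (m - 2) (m - 1) m.+1 0 j = (j.*2.+1 == m).
  case: (ltnP m 3) => m3.
    have -> : m = 1%N by lia.
    by rewrite /S_exponent /=; case: j j0 {jn}.
  have m1 : (0 < m - 1)%N by lia.
  have m2 : (0 < m - 2)%N by lia.
  by rewrite S_exponent_slot // /S_slot ltnNge leqnSn /=; congr nat_of_bool; lia.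
case: (ltnP m j.*2) => mj.
  rewrite (_ : (j.*2 + false <= m - 2) = false)%N; last by lia.
  rewrite (_ : (j.*2 + 3 <= m) = false)%N; last by lia.
  rewrite (_ : (j.*2.+1 == m) = false)%N; last by lia.
  by rewrite (_ : (m.+1 < j.*2 + true) = true)%N; [case: ifP; case: ifP|]; lia.
rewrite (_ : (m.+1 < j.*2 + true) = false)%N; last by lia.
rewrite (_ : (j.*2 < n)%N = true); last by lia.
rewrite (_ : (j.*2 + true <= n - 1)%N = true); last by lia.
case: (eqVneq j.*2.+1 m) => jm.
  rewrite (_ : (j.*2 + 3 <= m) = false)%N; last by lia.
  by case: ifP; lia.
rewrite (_ : (j.*2 + 3 <= m) = true)%N; last by lia.
rewrite (_ : (j.*2 + false <= m - 2)%N = true); lia.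
Qed.

(** The side of a pair lies in one triangle for each earlier vertex other than [m]. Any other side
    avoiding [m] lies only in the triangle [i, i + 1, i + 2]. *)
Let Sm_edge_even i : ~~ odd m -> (0 < i)%N -> (i < n)%N ->
  Sm_exponent n m i i.+1 =
  (if i < m then if odd i then (i.+1 < m : nat) else i.-1
   else if i == m then 0 else if odd i then i - 2 else 1)%N.
Proof.
move=> m_even i0 i_n; rewrite Sm_exponent_even //.
rewrite (_ : block 1 m (m - 2) S _ i i.+1 =
  (if (odd i == false) && (i <= m - 2) then \sum_(1 <= k < m) (k < i : nat) else 0)
  + (if [&& 1 <= i, i < m, i < i.+1, i < m - 2 & odd i != false] then 1 else 0))%N;
  last by apply: block_edge => // *; lia.
rewrite (_ : block 1 m (n - 1) _ _ i i.+1 =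
  (if (odd i == true) && (i <= n - 1) then \sum_(1 <= k < m) (m < i : nat) else 0)
  + (if [&& 1 <= i, i < m, m < i.+1, i < n - 1 & odd i != true] then 1 else 0))%N;
  last by apply: block_edge => // *; lia.
rewrite (_ : block m.+1 (n - 1) (n - 1) _ _ i i.+1 =
  (if (odd i == true) && (i <= n - 1) then \sum_(m.+1 <= k < n - 1) (k < i : nat) else 0)
  + (if [&& m.+1 <= i, i < n - 1, i < i.+1, i < n - 1 & odd i != true] then 1 else 0))%N;
  last by apply: block_edge => // *; lia.
rewrite !sum_ltn sum_nat_const_nat.
case: (boolP (odd i)) => oi /=; case: (ltngtP i m) => im /=; rewrite ?muln0 ?muln1;
  lia_ifs.
Qed.

(** The value 3 at odd [i] comes from [extra]; for [i = m - 2] only the triangle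
    [m - 2, m - 1, m + 1] contains the side. *)
Let Sm_edge_odd i : odd m -> (0 < i)%N -> (i < n)%N ->
  Sm_exponent n m i i.+1 =
  (if i < m then
     if odd i then if i.+2 == m then 1 else 3 else if i.+1 == m then 0 else i.-1
   else if i == m then 0 else if odd i then i - 2 else 1)%N.
Proof.
move=> m_odd i0 i_n; rewrite Sm_exponent_odd // -/(extra i i.+1) extra_edge //.
rewrite (_ : block 1 (m - 4).+1 (m - 2) _ _ i i.+1 =
  (if (odd i == false) && (i <= m - 2)
   then \sum_(1 <= k < (m - 4).+1) (k.+2 <= i : nat) else 0)
  + (if [&& 1 <= i, i < (m - 4).+1, i.+2 <= i.+1, i < m - 2 & odd i != false]
     then 1 else 0))%N;
  last by apply: block_edge => // *; lia.
rewrite (_ : block 1 m (n - 1) _ _ i i.+1 =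
  (if (odd i == true) && (i <= n - 1) then \sum_(1 <= k < m) (m.+1 < i : nat) else 0)
  + (if [&& 1 <= i, i < m, m.+1 < i.+1, i < n - 1 & odd i != true] then 1 else 0))%N;
  last by apply: block_edge => // *; lia.
rewrite (_ : block m.+1 (n - 1) (n - 1) _ _ i i.+1 =
  (if (odd i == true) && (i <= n - 1) then \sum_(m.+1 <= k < n - 1) (k < i : nat) else 0)
  + (if [&& m.+1 <= i, i < n - 1, i < i.+1, i < n - 1 & odd i != true] then 1 else 0))%N;
  last by apply: block_edge => // *; lia.
rewrite (eq_bigr (fun k => (k < i.-1 : nat))%N); last by move=> k _; congr nat_of_bool; lia.
rewrite !sum_ltn sum_nat_const_nat.
have -> : S_exponent m (m - 2) (m - 1) m.+1 i i.+1 = (i.+2 == m).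
  case: (ltnP m 3) => m3.
    have -> : m = 1%N by lia.
    by rewrite /S_exponent /=; case: i i0 {i_n}.
  have m1 : (0 < m - 1)%N by lia.
  have m2 : (0 < m - 2)%N by lia.
  rewrite S_exponent_pair //.
  rewrite eqSS (_ : (i.+1 == m - 1)%N = (i.+2 == m)); last by lia.
  rewrite (_ : (i == m - 2)%N = (i.+2 == m)); last by lia.
  by case: eqP; case: eqP; case: eqP; lia.
case: (boolP (odd i)) => oi /=; case: (ltngtP i m) => im /=; rewrite ?muln0 ?muln1;
  lia_ifs.
Qed.

(** The triangles of S(m) cover each diagonal that avoids [m] exactly once. *)
Let Sm_far i j : (0 < i)%N -> (i.+1 < j)%N -> (j <= n)%N ->
  Sm_exponent n m i j = (if (i == m) || (j == m) then 0 else 1)%N.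
Proof.
move=> i0 ij jn; case: (boolP (odd m)) => m_odd.
  rewrite Sm_exponent_odd // -/(extra i j) extra_far //.
  rewrite (_ : block 1 (m - 4).+1 (m - 2) _ _ i j = (
    let v := if odd j == false then j else j.-1 in
    if [&& 1 <= i, i < (m - 4).+1, i.+2 <= v & v <= m - 2] then 1 else 0))%N;
    last by apply: block_far => // *; lia.
  rewrite (_ : block 1 m (n - 1) _ _ i j = (
    let v := if odd j == true then j else j.-1 in
    if [&& 1 <= i, i < m, m.+2 <= v & v <= n - 1] then 1 else 0))%N;
    last by apply: block_far => // *; lia.
  rewrite (_ : block m.+1 (n - 1) (n - 1) _ _ i j = (
    let v := if odd j == true then j else j.-1 in
    if [&& m.+1 <= i, i < n - 1, i < v & v <= n - 1] then 1 else 0))%N;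
    last by apply: block_far => // *; lia.
  have -> : S_exponent m (m - 2) (m - 1) m.+1 i j =
      ((j == m.+1) && ((i.+1 == m) || (i.+2 == m)))%N.
    case: (ltnP m 3) => m3.
      have -> : m = 1%N by lia.
      by rewrite /S_exponent /=; lia.
    have m1 : (0 < m - 1)%N by lia.
    have m2 : (0 < m - 2)%N by lia.
    rewrite S_exponent_pair // (_ : (i == m - 1)%N = (i.+1 == m)); last by lia.
    rewrite (_ : (i == m - 2)%N = (i.+2 == m)); last by lia.
    by case: eqP; case: eqP; case: eqP => /=; lia.
  cbv zeta; case: (ltngtP i m) => im; last first.
  - lia_ifs.
  - lia_ifs.
  - by case: (ltngtP j m) => jm; lia_ifs.
rewrite Sm_exponent_even //.
rewrite (_ : block 1 m (m - 2) S _ i j = (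
  let v := if odd j == false then j else j.-1 in
  if [&& 1 <= i, i < m, i < v & v <= m - 2] then 1 else 0))%N;
  last by apply: block_far => // *; lia.
rewrite (_ : block 1 m (n - 1) _ _ i j = (
  let v := if odd j == true then j else j.-1 in
  if [&& 1 <= i, i < m, m < v & v <= n - 1] then 1 else 0))%N;
  last by apply: block_far => // *; lia.
rewrite (_ : block m.+1 (n - 1) (n - 1) _ _ i j = (
  let v := if odd j == true then j else j.-1 in
  if [&& m.+1 <= i, i < n - 1, i < v & v <= n - 1] then 1 else 0))%N;
  last by apply: block_far => // *; lia.
cbv zeta; case: (boolP (odd j)) => oj /=; case: (ltngtP i m) => im /=;
  case: (ltngtP j m) => jm /=; lia_ifs.
Qed.


Let x_exponent_edge p i : (0 < i)%N ->
  x_exponent p p.+1 i i.+1 = (if p == i then 2 else 0)%N.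
Proof.
move=> i0; rewrite /x_exponent eqSS [p == i]eq_sym andbb orbF.
by case: (eqVneq p 0%N) => [->|p0]; [rewrite (gtn_eqF i0)|case: eqP].
Qed.

Let x_exponent_nonedge p i j : (i == 0)%N || (j != i.+1) -> x_exponent p p.+1 i j = 0%N.
Proof.
rewrite /x_exponent orbF; case: (eqVneq p 0%N) => //= p0.
by case: (eqVneq i p) => [->|] //; rewrite (negbTE p0) /= => /negbTE ->.
Qed.

Let sum_x_edge a b (P : pred nat) w i : (0 < i)%N ->
  (\sum_(a <= l < b | P l) w l * x_exponent l l.+1 i i.+1
   = if [&& a <= i, i < b & P i] then w i * 2 else 0)%N.
Proof.
move=> i0; rewrite -(sum_eq_pt a b P (fun l => (w l * 2)%N)); apply: eq_bigr => l _.
by rewrite x_exponent_edge //; case: ifP; rewrite ?muln0.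
Qed.

(** The chords at [m] supply the diagonals missing from S(m). The factors of x(m) are all sides, so
    they leave slots and diagonals alone and only even out the exponents of the sides. *)
Lemma total_exponent i j : (i < j)%N -> (j <= n)%N ->
  (xm_exponent n m i j + Sm_exponent n m i j
   + (\sum_(1 <= p < m) ((i == p) && (j == m))
      + \sum_(m.+1 <= q < n.+1) ((i == m) && (j == q)))
   = common_exponent n i j)%N.
Proof.
move=> ij jn.
have -> : (\sum_(1 <= p < m) ((i == p) && (j == m)) = (0 < i) && (i < m) && (j == m))%N.
  rewrite (eq_bigr (fun p => if p == i then (j == m : nat) else 0)%N); last first.
    by move=> p _; rewrite eq_sym; case: eqP.
  by rewrite sum_eq_pt andbT; case: ifP.
have -> : (\sum_(m.+1 <= q < n.+1) ((i == m) && (j == q)) = (i == m))%N.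
  rewrite (eq_bigr (fun q => if q == j then (i == m : nat) else 0)%N); last first.
    by move=> q _; rewrite andbC eq_sym; case: eqP.
  by rewrite sum_eq_pt andbT; case: ifP => //; case: (eqVneq i m); lia.
(* For [m = 1] both indices truncate to [0], so the pair is no longer consecutive and needs separate
   treatment. *)
have m3 : odd m -> (m - 2).+1 = (m - 1)%N \/ m = 1%N by lia.
have x21 : odd m -> x_exponent (m - 2) (m - 1) i j = x_exponent (m - 2) (m - 2).+1 i j.
  by move=> /m3[->|->].
rewrite /xm_exponent /common_exponent.
have [i0|i0] := posnP i.
  rewrite i0 in ij x21 *.
  have xz p : x_exponent p p.+1 0 j = 0%N by apply: x_exponent_nonedge.
  rewrite !xz !muln0 /=.
  rewrite !big1; try by move=> l _; rewrite xz muln0.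
  case: ifPn => m_odd; first by rewrite Sm_slot_even //; case: ifP; case: eqP; lia.
  rewrite negbK in m_odd; rewrite Sm_slot_odd // x21 // xz muln0.
  by do !case: ifP; case: eqP; lia.
have [ji|ji] := eqVneq j i.+1.
  rewrite ji in ij jn x21 *; rewrite /= !sum_x_edge // !x_exponent_edge // ?eqxx.
  case: ifPn => m_odd.
    rewrite Sm_edge_even //.
    by case: (boolP (odd i)) => oi; case: (ltngtP i m) => im /=; lia_ifs.
  rewrite negbK in m_odd; rewrite Sm_edge_odd // x21 // x_exponent_edge //.
  case: (boolP (odd i)) => oi; case: (ltngtP i m) => im /=; case: ifP => n6;
    lia_ifs.
have xz p : x_exponent p p.+1 i j = 0%N by apply: x_exponent_nonedge; rewrite ji orbT.
rewrite !xz !muln0 /=.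
rewrite !big1; try by move=> l _; rewrite xz muln0.
rewrite Sm_far //; last by lia.
case: ifPn => m_odd; last rewrite negbK in m_odd; rewrite ?x21 ?xz ?muln0 //;
  case: eqP; case: eqP => /=; lia_ifs.
Qed.

End Counting.

(** * The alternating sum *)

Lemma prod_neq_nat (R : comPzRingType) (n m : nat) (F : nat -> R) :
  (1 <= m <= n)%N ->
  \prod_(1 <= j < n.+1 | j != m) F j
  = \prod_(1 <= j < m) F j * \prod_(m.+1 <= j < n.+1) F j.
Proof.
move=> /andP[m1 mn]; rewrite (big_cat_nat _ (n := m)) //=; last exact: leqW.
rewrite [X in _ * X]big_ltn_cond ?ltnS // eqxx /=.
by congr (_ * _); rewrite big_nat_cond [RHS]big_nat_cond; apply: eq_bigl => j; lia.
Qed.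

Theorem theorem3p1 (R : realType) (n : nat) (A : nat -> R * R) :
  (4 < n)%N -> ~~ odd n -> cyclic_anticlockwise n A ->
  \sum_(1 <= m < n.+1) (-1) ^+ m.+1 * xm A n m * Sm A n m = 0.
Proof.
move=> n4 n_even [_ [c [r [theta [r_gt0 [A_theta [theta_incr theta_n]]]]]]].
pose h i := theta i / 2.
have h_incr i : (1 <= i < n)%N -> h i < h i.+1.
  by move=> i_n; rewrite /h ltr_pM2r ?invr_gt0 ?ltr0n // theta_incr.
have h_n : h n < h 1%N + pi by rewrite /h; lra.
have sin_gt0 := sin_sub_gt0 _ _ _ h_incr h_n.
have Ah i : (0 < i)%N -> (i <= n)%N ->
    A i = (c.1 + r * cos (2 * h i), c.2 + r * sin (2 * h i)).
  have -> : 2 * h i = theta i by rewrite /h; lra.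
  by move=> i0 i_n; rewrite A_theta ?i0.
have r_neq0 := lt0r_neq0 r_gt0.
(* Row [0] is constantly [1 / r], whatever the slot. *)
pose d (p q : nat) := if (p == 0)%N then r^-1 else 2 * r * sin (h q - h p).
have xdE p q : (0 < p)%N -> (p < q)%N -> (q <= n)%N -> xd A p q = d p q ^+ 2.
  move=> p0 pq qn; rewrite /d (gtn_eqF p0).
  by apply: (xd_circle _ _ c); rewrite ?Ah //; lia.
have SaE p q s i : (0 < p)%N -> (p < q)%N -> (q < s)%N -> (s <= n)%N ->
    Sa A p q s = d 0%N i * d p q * d q s * d p s.
  move=> p0 pq qs sn; have q0 := ltn_trans p0 pq.
  rewrite /d eqxx (gtn_eqF p0) (gtn_eqF q0).
  by apply: (Sa_circle _ _ c); rewrite ?Ah //; lia.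
pose C := \prod_(0 <= p < n.+1) \prod_(p.+1 <= q < n.+1) d p q ^+ common_exponent n p q.
pose s m := \prod_(1 <= j < n.+1 | j != m) sin (h m - h j).
have termE m : (1 <= m <= n)%N ->
    (-1) ^+ m.+1 * xm A n m * Sm A n m = - C / (2 * r) ^+ n.-1 * (s m)^-1.
  move=> m_n; have /andP[m1 mn] := m_n.
  have : xm A n m * Sm A n m *
      (\prod_(1 <= p < m) d p m * \prod_(m.+1 <= q < n.+1) d m q) = C.
    apply: (has_exponent_eq _ n d); last exact: (total_exponent n m n4 n_even m_n).
    - apply: has_exponentM; first apply: has_exponentM.
      + exact: xm_has_exponent.
      + exact: Sm_has_exponent.
      + by apply: has_exponentM; apply: has_exponent_prod => l ? ?;
          apply: has_exponent_var; lia.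
    - by [].
  (* The [n - m] chords to later vertices have the sine reversed; as [n] is even, their sign is
     [(-1) ^ m], which cancels the alternation of the sum and leaves a constant factor. *)
  have -> : \prod_(1 <= p < m) d p m * \prod_(m.+1 <= q < n.+1) d m q
      = (-1) ^+ m * (2 * r) ^+ n.-1 * s m.
    rewrite /s prod_neq_nat //.
    rewrite (eq_big_nat _ _ (F2 := fun p => 2 * r * sin (h m - h p))); last first.
      by move=> p /andP[p0 _]; rewrite /d (gtn_eqF p0).
    rewrite [X in _ * X](eq_big_nat _ _ (F2 := fun q => - (2 * r) * sin (h m - h q)));
      last first.
      by move=> q _; rewrite /d (gtn_eqF m1) -opprB sinN mulrN mulNr.
    rewrite !big_split /= !prodr_const_nat mulrACA; congr (_ * _).
    rewrite -exprMn [(- (2 * r)) ^+ _]exprNn mulrCA -exprD subSS.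
    have -> : (m - 1 + (n - m) = n.-1)%N by lia.
    by rewrite -signr_odd oddB // (negbTE n_even) signr_odd.
  have s_neq0 : s m != 0.
    rewrite prodf_seq_neq0; apply/allP => j; rewrite mem_index_iota => /andP[j1 jn].
    apply/implyP; rewrite neq_ltn => /orP[jm|mj]; first by rewrite gt_eqF // sin_gt0.
    by rewrite -opprB sinN oppr_eq0 gt_eqF // sin_gt0.
  have r2_neq0 : (2 * r) ^+ n.-1 != 0 by rewrite expf_neq0 // mulf_neq0 // pnatr_eq0.
  by move=> <-; rewrite exprS; field; rewrite r2_neq0 s_neq0.
rewrite (eq_big_nat _ _ (F2 := fun m => - C / (2 * r) ^+ n.-1 * (s m)^-1)) //.
rewrite -mulr_sumr.
by rewrite sum_inv_prod_sin_lt_eq0 ?mulr0 //; lia.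
Qed.
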